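(* Let $Y$ be a real topological vector space and $f:Y\to\overline{\mathbb{R}}$. Then $f$ is continuous if and only if $\operatorname{epi}f$ is closed in $Y\times\mathbb{R}$ and $$\operatorname{epi}f+\mathbb{R}_{>}\cdot(0_Y,1)\subseteq\operatorname{int}(\operatorname{epi}f).$$
   Context: $\overline{\mathbb{R}}=\mathbb{R}\cup\{-\infty,+\infty\}$ with its usual order topology, $\mathbb{R}_{>}=\{x\in\mathbb{R}:x>0\}$, $\operatorname{epi}f=\{(y,t)\in Y\times\mathbb{R}: f(y)\le t\}$, and $\mathbb{R}_{>}\cdot(0_Y,1)=\{(0_Y,\lambda):\lambda>0\}$. The interior is taken in $Y\times\mathbb{R}$ with the product topology. *)

(* Defs.v *)
From mathcomp Require Import all_boot all_order all_algebra.
From mathcomp Require Import all_classical all_reals all_analysis.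

Set Implicit Arguments.
Unset Strict Implicit.
Unset Printing Implicit Defensive.

Import Order.TTheory GRing.Theory Num.Theory.
Import numFieldNormedType.Exports.

Local Open Scope classical_set_scope.
Local Open Scope ring_scope.

(* A point (y, t) of the epigraph has a finite height t : R, so the fibre over
   y is empty when f y = +oo and all of R when f y = -oo. *)
Definition epi (R : realType) (Y : Type) (f : Y -> \bar R) : set (Y * R) :=
  [set p | (f p.1 <= p.2%:E)%E].

Definition set_sum (V : zmodType) (A B : set V) : set V :=
  [set a + b | a in A & b in B].

(* The open half-line of positive multiples of (0, 1) in Y * R. *)
Definition vertical_ray (R : realType) (Y : zmodType) : set (Y * R) :=
  [set (0, l) | l in [set l : R | 0 < l]].
Arguments vertical_ray : clear implicits.

(* Main.v *)
(* Both sides say that f is lower and upper semicontinuous: the epigraph is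
   closed iff f is lower semicontinuous, and the sum of the epigraph and the
   vertical ray is the strict epigraph {f y < t}, which lies in the interior of
   the epigraph iff f is upper semicontinuous. *)

Require Import Defs.
From mathcomp Require Import all_boot all_order all_algebra.
From mathcomp Require Import all_classical all_reals all_analysis.
Import Order.TTheory GRing.Theory Num.Theory.
Import numFieldNormedType.Exports.
Local Open Scope classical_set_scope.
Local Open Scope ring_scope.

Lemma lte_real_between {R : realType} {x y : \bar R} :
  (x < y)%E -> exists r : R, (x < r%:E)%E /\ (r%:E < y)%E.
Proof.
case: x y => [x| |] [y| |] //= xy.
- exists ((x + y) / 2); rewrite !lte_fin; rewrite lte_fin in xy.
  by rewrite !midf_lt.
- by exists (x + 1); rewrite lte_fin ltrDl ltry.
- by exists (y - 1); rewrite lte_fin gtrBl ltNyr.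
- by exists 0; rewrite ltNyr ltry.
Qed.

(** Open rays with real endpoints form a subbase of the topology of [\bar R]: a neighbourhood of a
    finite value contains an intersection of two such rays, and one of an infinite value contains a
    single ray. *)
Lemma continuous_ereal_openP (R : realType) (T : topologicalType)
    (f : T -> \bar R) :
  continuous f <->
  (forall a : R, open [set x | (a%:E < f x)%E]) /\
  (forall a : R, open [set x | (f x < a%:E)%E]).
Proof.
split=> [cf|[lf uf] x].
  split=> a; rewrite openE => x /=; first by move=> /open_ereal_gt'; exact: cf.
  by move=> /open_ereal_lt'; exact: cf.
have lfx a : (a%:E < f x)%E -> \forall z \near x, (a%:E < f z)%E.
  by move=> afx; apply: open_nbhs_nbhs; split=> //; exact: lf.
have ufx a : (f x < a%:E)%E -> \forall z \near x, (f z < a%:E)%E.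
  by move=> fxa; apply: open_nbhs_nbhs; split=> //; exact: uf.
move=> A; rewrite /nbhs/= /ereal_nbhs /=.
case: (f x) lfx ufx => [r| |] lfx ufx.
- move=> /nbhs_ballP[e /= e0 eA].
  have : \forall z \near x, ((r - e)%:E < f z)%E.
    by apply: lfx; rewrite lte_fin gtrBl.
  have : \forall z \near x, (f z < (r + e)%:E)%E.
    by apply: ufx; rewrite lte_fin ltrDl.
  apply: filterS2 => z; rewrite /preimage/=; case: (f z) => [s| |]//=; rewrite !lte_fin => sr rs.
  by apply: eA; rewrite /ball/= ltr_distlC rs sr.
- by move=> [M [_ MA]]; apply: filterS (lfx M (ltry M)) => z /MA.
- by move=> [M [_ MA]]; apply: filterS (ufx M (ltNyr M)) => z /MA.
Qed.

Lemma closed_epiP (R : realType) (T : topologicalType) (f : T -> \bar R) :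
  closed (epi f) <-> forall a : R, open [set x | (a%:E < f x)%E].
Proof.
have epiC x (t : R) : (~` epi f) (x, t) = (t%:E < f x)%E :> Prop.
  by rewrite /epi/= ltNge; apply/propext; split => /negP.
rewrite -openC; split=> [oC a|lf]; rewrite openE.
  move=> x /= ax; have : (~` epi f) (x, a) by rewrite epiC.
  move=> Cxa; have [[U V] /= [Ux Va] UV] := open_nbhs_nbhs (conj oC Cxa).
  apply: filterS Ux => z Uz /=; rewrite -epiC.
  by apply: UV; split=> //; exact: nbhs_singleton.
move=> [x t]; rewrite epiC => /lte_real_between[a [ta ax]].
(* Since [t < a < f x], this box contains [(x, t)]; at each of its points [s < a < f z], so it
   misses the epigraph. *)
exists ([set x | (a%:E < f x)%E], [set s | s < a]) => /=.
  split; last exact: lt_nbhsl.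
  by apply: open_nbhs_nbhs; split=> //; exact: lf.
move=> [z s] [/= afz sa].
suff: (s%:E < f z)%E by rewrite -epiC.
by rewrite (lt_trans _ afz)// lte_fin.
Qed.

Lemma strict_epi_interiorP (R : realType) (T : topologicalType)
    (f : T -> \bar R) :
  [set p | (f p.1 < p.2%:E)%E] `<=` (epi f)° <->
  forall a : R, open [set x | (f x < a%:E)%E].
Proof.
split=> [sub a|uf [x t] /= /lte_real_between[a [fxa at_]]].
  (* A slice of the epigraph at height [a] would only give [f z <= a]; slicing at a real [b]
     strictly below [a] makes the bound strict. *)
  rewrite openE => x /lte_real_between[b [xb ba]].
  have [[U V] /= [Ux Vb] UV] := sub (x, b) xb.
  apply: filterS Ux => z Uz; apply: le_lt_trans ba.
  by apply: (UV (z, b)); split=> //; exact: nbhs_singleton.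
exists ([set x | (f x < a%:E)%E], [set s | a < s]) => /=.
  split; last exact: lt_nbhsr.
  by apply: open_nbhs_nbhs; split=> //; exact: uf.
move=> [z s] /= [fza as_]; rewrite /epi/=.
by rewrite (le_trans (ltW fza))// lee_fin ltW.
Qed.

Lemma set_sum_vertical_ray (R : realType) (V : zmodType) (f : V -> \bar R) :
  set_sum (epi f) (vertical_ray R V) = [set p | (f p.1 < p.2%:E)%E].
Proof.
apply/seteqP; split=> [_ [[y t] /= fyt [_ [l /= l0 <-] <-]]|[y t] /= fyt].
  by rewrite /= addr0 (le_lt_trans fyt)// lte_fin ltrDl.
(* [f y] may be [-oo], so the point of the epigraph is taken at a real height [s] strictly between
   [f y] and [t]. *)
have [s [fys st]] := lte_real_between fyt; rewrite lte_fin in st.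
exists (y, s); first exact: ltW.
exists (0, t - s); first by exists (t - s) => //=; rewrite subr_gt0.
by congr pair; rewrite /= ?addr0// subrKC.
Qed.

(* MathComp-Analysis world.  A topologicalLmodType is a general topological
   vector space: no separation and no local convexity (tvsType adds the latter). *)
Theorem proposition22 (R : realType) (Y : topologicalLmodType R)
    (f : Y -> \bar R) :
  continuous f <->
  closed (epi f) /\ set_sum (epi f) (vertical_ray R Y) `<=` (epi f)°.
Proof.
by rewrite set_sum_vertical_ray continuous_ereal_openP closed_epiP
  strict_epi_interiorP.
Qed.
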